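(* Let $E$ and $F$ be positive idempotent $n \times n$ matrices such that $EF \ge FE$. Then the unital algebra generated by $E$ and $F$ is equal to the linear span of the set $\{I, E, F, EF, FE, EFE, FEF, (EF)^2, (FE)^2\}$, and so its dimension is at most $9$.
   Context: A matrix is called positive if all its entries are nonnegative real numbers; $M \ge N$ means that $M - N$ is positive in this sense (entrywise inequality). A matrix $E$ is idempotent if $E^2 = E$. $I$ is the identity matrix. *)

(* Defs.v *)
From HB Require Import structures.
From mathcomp Require Import all_boot all_order all_algebra all_field.

Set Implicit Arguments.
Unset Strict Implicit.
Unset Printing Implicit Defensive.

Import Order.TTheory GRing.Theory Num.Theory.
Local Open Scope ring_scope.

(* Over a numFieldType, which may be a field of real or of complex numbers,
   0 <= x says that x is real and nonnegative. *)
Definition mx_positive (K : numFieldType) (n : nat) (M : 'M[K]_n) : Prop :=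
  M \is a mxOver Num.nneg.

Definition mx_ge (K : numFieldType) (n : nat) (M N : 'M[K]_n) : Prop :=
  mx_positive (M - N).

(* Main.v *)
(* For D = EF - FE, idempotence gives EFDE = EFEFE - EFE = - EDFE.  As D, E and
   F are positive, this matrix and its opposite are positive, so EFEFE = EFE;
   likewise FEFEF = FEF.  Hence the span of the nine words is stable under left
   multiplication by E and F. *)
Require Import Defs.
From HB Require Import structures.
From mathcomp Require Import all_boot all_order all_algebra all_field.

Set Implicit Arguments.
Unset Strict Implicit.
Unset Printing Implicit Defensive.

Import Order.TTheory GRing.Theory Num.Theory.
Local Open Scope ring_scope.

Section PositiveMatrices.

Variables (K : numFieldType) (n : nat).
Implicit Types E F M N : 'M[K]_n.+1.

Lemma mx_positiveM M N :
  mx_positive M -> mx_positive N -> mx_positive (M * N).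
Proof. exact: mxOverM. Qed.

Lemma mx_positive_anti M N :
  mx_positive (M - N) -> mx_positive (N - M) -> M = N.
Proof.
move=> /mxOverP leNM /mxOverP leMN; apply/matrixP=> i j.
have := leNM i j; have := leMN i j.
rewrite !mxE !nnegrE !subr_ge0 => leMNij leNMij.
by apply/le_anti; rewrite leMNij.
Qed.

Lemma idem_words_stabilize E F :
    mx_positive E -> mx_positive F -> E * E = E -> F * F = F ->
    mx_ge (E * F) (F * E) ->
  E * F * E * F * E = E * F * E /\ F * E * F * E * F = F * E * F.
Proof.
move=> E_pos F_pos EE FF geEF.
(* In left-associated words, a square past the first letter appears as [x * E * E], which [EE] does
   not match. *)
have EEr x : x * E * E = x * E by rewrite -mulrA EE.
have FFr x : x * F * F = x * F by rewrite -mulrA FF.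
split; apply: mx_positive_anti.
- have -> : E * F * E * F * E - E * F * E = E * F * (E * F - F * E) * E.
    by rewrite mulrBr mulrBl !mulrA FFr EEr.
  by do !apply: mx_positiveM.
- have -> : E * F * E - E * F * E * F * E = E * (E * F - F * E) * F * E.
    by rewrite mulrBr !mulrBl !mulrA EE FFr.
  by do !apply: mx_positiveM.
(* The hypothesis is not symmetric: exchanging E and F turns D into -D. Both signs of the difference
   are bounded, so the argument survives with the two factorizations in swapped roles: FDEF = FEFEF
   - FEF = - FEDF. *)
- have -> : F * E * F * E * F - F * E * F = F * (E * F - F * E) * E * F.
    by rewrite mulrBr !mulrBl !mulrA FF EEr.
  by do !apply: mx_positiveM.
- have -> : F * E * F - F * E * F * E * F = F * E * (E * F - F * E) * F.
    by rewrite mulrBr mulrBl !mulrA EEr FFr.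
  by do !apply: mx_positiveM.
Qed.

End PositiveMatrices.

(** A subspace that contains 1 and is stable under left multiplication by the generators absorbs any
    product of generators, letter by letter from the right end. By bilinearity, stability need only
    be tested on [xs] and [ys]. *)
Lemma adjoin_seq_span_words (K : fieldType) (A : falgType K) (xs ys : seq A) :
    1 \in ys -> {subset ys <= <<1 & xs>>%VS} ->
    {in xs & ys, forall x y, x * y \in ys} ->
  <<1 & xs>>%VS = <<ys>>%VS.
Proof.
move=> ys1 ys_sub ys_mul; apply: subv_anti.
have -> : (<<ys>> <= <<1 & xs>>)%VS by apply/span_subvP.
have sub1 : (1 <= <<ys>>)%VS by rewrite -memvE memv_span.
rewrite andbT agenv_sub_modl // prodvDl prod1v subv_add subvv /=.
apply/prodvP=> x y.
move=> /(coord_span (X := in_tuple xs))-> /(coord_span (X := in_tuple ys))->.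
rewrite mulr_suml memv_suml // => i _; rewrite mulr_sumr memv_suml // => j _.
rewrite -scalerAr -scalerAl !memvZ // memv_span // ys_mul //; exact: mem_nth.
Qed.

Theorem corollary4p7 (K : numFieldType) (n : nat) (E F : 'M[K]_n.+1)
    (E_pos : mx_positive E) (F_pos : mx_positive F)
    (E_idem : E ^+ 2 = E) (F_idem : F ^+ 2 = F)
    (geEF : mx_ge (E * F) (F * E)) :
  <<1 & [:: E; F]>>%VS =
    <<[:: 1; E; F; E * F; F * E; E * F * E; F * E * F;
          (E * F) ^+ 2; (F * E) ^+ 2]%R>>%VS
  /\ (\dim <<1 & [:: E; F]>>%VS <= 9)%N.
Proof.
have EE : E * E = E by rewrite -expr2.
have FF : F * F = F by rewrite -expr2.
have [EFEFE FEFEF] := idem_words_stabilize E_pos F_pos EE FF geEF.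
set ys := [:: 1; _; _; _; _; _; _; _; _].
have -> : <<1 & [:: E; F]>>%VS = <<ys>>%VS; last by split=> //; exact: dim_span.
apply: adjoin_seq_span_words; first exact: mem_head.
  set A := <<1 & _>>%VS.
  have A1 : 1 \in A by rewrite memvE sub1_agenv.
  have AM x y : x \in A -> y \in A -> x * y \in A.
    by move: x y; apply/prodvP; rewrite agenvM.
  have AE : E \in A by rewrite seqv_sub_adjoin ?mem_head.
  have AF : F \in A by rewrite seqv_sub_adjoin ?inE ?eqxx ?orbT.
  by apply/allP; rewrite /= !expr2 A1 AE AF !AM.
(* Words are right-associated from here on, so these forms reduce a square at the head of a longer
   word. *)
have EEl x : E * (E * x) = E * x by rewrite mulrA EE.
have FFl x : F * (F * x) = F * x by rewrite mulrA FF.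
(* Makes the products syntactically those of the ring of matrices, not those of
   the falgType structure, so that the rewrite rules match. *)
suff: allrel (fun x y : 'M[K]_n.+1 => x * y \in ys) [:: E; F] ys by move/allrelP.
rewrite /ys !expr2 /allrel /= !mulr1.
rewrite -!mulrA in EFEFE FEFEF *.
(* Only E(FE)^2 and F(EF)^2 need [EFEFE] and [FEFEF]; idempotence settles the other products or they
   are already listed. *)
by rewrite !(EE, FF, EEl, FFl, EFEFE, FEFEF) !inE !eqxx !orbT.
Qed.
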